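(* Let $4.2$ denote the $3$-graph on $4$ vertices with exactly $2$ edges, let $C_5$ be the $3$-graph on $\{1,\dots,5\}$ with edges $123,234,345,451,512$, and let $F_{3,2}$ be the $3$-graph on $\{1,\dots,5\}$ with edges $123,124,125,345$. Then \[\pi_{4.2}(\{C_5,F_{3,2}\})=\frac{9}{16}.\]
   Context: A $3$-graph is a pair $G=(V,E)$ with $E$ a set of $3$-element subsets of $V$. For a $3$-graph $H$ on $h$ vertices and a $3$-graph $G$ on $n\ge h$ vertices, $e_H(G)$ is the number of $h$-subsets of $V(G)$ inducing a subgraph isomorphic to $H$. For a family $\mathcal{F}$ of $3$-graphs, $G$ is $\mathcal{F}$-free if it contains no member of $\mathcal{F}$ as a (not necessarily induced) subgraph. $\mathrm{ex}_H(n,\mathcal{F})$ is the maximum of $e_H(G)$ over $\mathcal{F}$-free $G$ on $n$ vertices, and $\pi_H(\mathcal{F})=\lim_{n\to\infty}\mathrm{ex}_H(n,\mathcal{F})/\binom{n}{h}$ (the limit exists). *)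

(* Defs.v *)
From HB Require Import structures.
From mathcomp Require Import all_boot all_order all_algebra.
From mathcomp Require Import all_classical all_reals all_analysis.
Set Implicit Arguments.
Unset Strict Implicit.
Unset Printing Implicit Defensive.
Import Order.TTheory GRing.Theory Num.Theory.
Import numFieldNormedType.Exports.

Record graph3 (V : finType) := Graph3 {
  edges : {set {set V}};
  edges_card3 : [forall e in edges, #|e| == 3] }.

HB.instance Definition _ (V : finType) := [isSub for @edges V].
HB.instance Definition _ (V : finType) := [Finite of graph3 V by <:].

Definition isomorphic (V W : finType) (G : graph3 V) (H : graph3 W) : Prop :=
  exists2 f : V -> W, bijective f &
    forall e : {set V}, (e \in edges G) = (f @: e \in edges H).

Definition subgraph (V W : finType) (H : graph3 W) (G : graph3 V) : Prop :=
  exists2 f : W -> V, injective f &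
    forall e : {set W}, e \in edges H -> f @: e \in edges G.

Definition induced_edges (V : finType) (G : graph3 V) (S : {set V}) :
    {set {set {x : V | x \in S}}} :=
  [set e : {set {x : V | x \in S}} | val @: e \in edges G].

Fact induced_card3 (V : finType) (G : graph3 V) (S : {set V}) :
  [forall e in induced_edges G S, #|e| == 3].
Proof.
apply/forall_inP => e; rewrite inE => eG.
by rewrite -(card_imset (mem e) val_inj) (forall_inP (edges_card3 G)).
Qed.

Definition induced (V : finType) (G : graph3 V) (S : {set V}) :
  graph3 {x : V | x \in S} := Graph3 (induced_card3 G S).

Definition ind_count (V W : finType) (H : graph3 W) (G : graph3 V) : nat :=
  #|[set S : {set V} | (#|S| == #|W|) && `[< isomorphic (induced G S) H >]]|.

Definition graph3_family : Type := set {k : nat & graph3 'I_k}.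

Definition family_free (V : finType) (F : graph3_family) (G : graph3 V) : Prop :=
  forall K, F K -> ~ subgraph (projT2 K) G.

Definition ex_count (W : finType) (H : graph3 W) (n : nat)
    (F : graph3_family) : nat :=
  \max_(G : graph3 'I_n | `[< family_free F G >]) ind_count H G.

Definition turan_density (R : realType) (W : finType) (H : graph3 W)
    (F : graph3_family) : R :=
  limn (fun n : nat => ((ex_count H n F)%:R / 'C(n, #|W|)%:R : R)%R).

(* Vertices are labelled 1, .., n.+1, the label i standing for i.-1 : 'I_n.+1. *)
Definition triple (n a b c : nat) : {set 'I_n.+1} :=
  [set inord a.-1; inord b.-1; inord c.-1].

Fact card_triple n a b c : (0 < a <= n.+1) -> (0 < b <= n.+1) ->
  (0 < c <= n.+1) -> uniq [:: a; b; c] -> #|triple n a b c| == 3.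
Proof.
case: a b c => [|a] [|b] [|c] //= la lb lc.
rewrite !inE !eqSS negb_or andbT => /andP[/andP[ab ac] bc].
rewrite /triple finset.setUC cardsU1 cards2 !inE -!val_eqE /= !inordK //.
by rewrite ab negb_or ![c == _]eq_sym ac bc.
Qed.

Definition edges_4_2 : {set {set 'I_4}} := [set triple 3 1 2 3; triple 3 1 2 4].

Definition edges_C5 : {set {set 'I_5}} :=
  [set triple 4 1 2 3; triple 4 2 3 4; triple 4 3 4 5;
       triple 4 4 5 1; triple 4 5 1 2].

Definition edges_F32 : {set {set 'I_5}} :=
  [set triple 4 1 2 3; triple 4 1 2 4; triple 4 1 2 5; triple 4 3 4 5].

Fact edges_4_2_card3 : [forall e in edges_4_2, #|e| == 3].
Proof.
by apply/forall_inP => e; rewrite !inE => /orP[]/eqP->; apply: card_triple.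
Qed.

Fact edges_C5_card3 : [forall e in edges_C5, #|e| == 3].
Proof.
apply/forall_inP => e; rewrite !inE -!orbA.
do ?[case/orP=> [/eqP->|]; first exact: card_triple].
by move/eqP->; apply: card_triple.
Qed.

Fact edges_F32_card3 : [forall e in edges_F32, #|e| == 3].
Proof.
apply/forall_inP => e; rewrite !inE -!orbA.
do ?[case/orP=> [/eqP->|]; first exact: card_triple].
by move/eqP->; apply: card_triple.
Qed.

Definition G_4_2 : graph3 'I_4 := Graph3 edges_4_2_card3.
Definition C5 : graph3 'I_5 := Graph3 edges_C5_card3.
Definition F32 : graph3 'I_5 := Graph3 edges_F32_card3.

Definition C5_F32 : graph3_family :=
  [set existT (fun k => graph3 'I_k) 5 C5;
       existT (fun k => graph3 'I_k) 5 F32]%classic.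

(* Main.v *)
(** The lower bound is the balanced complete 4-partite 3-graph.  Both [C5] and
    [F32] cover every pair of their vertices, so 4-partite 3-graphs avoid them,
    and a random 4-tuple meets three parts in the pattern (2, 1, 1) with
    probability 144 / 256 = 9 / 16.

    The upper bound is a flag algebra argument on five vertices, made exact by
    sampling tuples with repetition: since the forbidden graphs cover pairs, any
    5-tuple of vertices of a free graph, possibly with repetitions, induces a
    free labelled 3-graph on five points.  The function [gap] is
    81 - 144 * [the first four points span 4.2] minus products whose sums over
    all 5-tuples are sums of squares; its sum over all orderings of the five
    points is nonnegative for each of the finitely many free labelled 3-graphs.
    Summing over all 5-tuples gives 144 * M <= 81 * n ^ 4, where M is the number
    of 4-tuples that span two edges. *)
Require Import Defs.
From Stdlib Require Import BinInt.
From mathcomp Require Import all_boot all_order all_algebra.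
From mathcomp Require Import all_classical all_reals all_analysis.
From mathcomp Require Import ssrZ zify lra.
Set Implicit Arguments.
Unset Strict Implicit.
Unset Printing Implicit Defensive.
Import Order.TTheory GRing.Theory Num.Theory.
Import numFieldNormedType.Exports.

(** * The five-vertex certificate *)

Section LocalFunctions.
Variables (T : Type) (e : T -> T -> T -> bool).
Local Open Scope Z_scope.

(** Repetitions are allowed: in a 3-graph, [[:: a; b; c; c]] qualifies whenever [e a b c] holds. *)
Definition two_edges (s : seq T) : bool :=
  if s is [:: a; b; c; d] then
    (e a b c + e a b d + e a c d + e b c d == 2)%N
  else false.

(* Each of the next four functions has mean zero over its last argument (for
   [link_dev], its last two) in the extremal graph; the weights in [gap] come
   from rounding the solution of the semidefinite program. *)
Definition link_dev (a b c : T) : Z := 8 * Z.b2z (e a b c) - 3.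

Definition mixed_dev (a b c w : T) : Z :=
  Z.b2z (e a b c) * (4 * Z.b2z (0 < e w b c + e w a c + e w a b < 3)%N - 3).

Definition edge_skew (a b c w : T) : Z :=
  Z.b2z (e a b c) * (Z.b2z (e w b c) - Z.b2z (e w a c)).

Definition nonedge_skew (a b c w : T) : Z :=
  Z.b2z (~~ e a b c && ~~ e w a b) * (Z.b2z (e w b c) - Z.b2z (e w a c)).

Definition gap (s : seq T) : Z :=
  if s is [:: a; b; c; d; f] then
    81 - 144 * Z.b2z (two_edges [:: a; b; c; d]) -
    (9 * (link_dev a b c * link_dev a d f)
     + 16 * (mixed_dev a b c d * mixed_dev a b c f)
     + 192 * (edge_skew a b c d * edge_skew a b c f)
     + 288 * (nonedge_skew a b c d * nonedge_skew a b c f))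
  else 0.

Definition C5_F32_at (s : seq T) : bool :=
  if s is [:: a; b; c; d; f] then
    [&& e a b c, e b c d, e c d f, e d f a & e f a b]
    || [&& e a b c, e a b d, e a b f & e c d f]
  else false.
End LocalFunctions.

(** * Exhaustive check of the labelled 3-graphs on five points *)

Definition triples5 : seq (seq nat) :=
  [:: [:: 0; 1; 2]; [:: 0; 1; 3]; [:: 0; 1; 4]; [:: 0; 2; 3]; [:: 0; 2; 4];
      [:: 0; 3; 4]; [:: 1; 2; 3]; [:: 1; 2; 4]; [:: 1; 3; 4]; [:: 2; 3; 4]].

(* Triples with a repetition get rank 10, which every [b : bitseq] of size 10
   maps to [false]. *)
Definition triple_rank : seq (seq (seq nat)) := Eval vm_compute in
  [seq [seq [seq index (sort leq [:: i; j; k]) triples5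
       | k <- iota 0 5] | j <- iota 0 5] | i <- iota 0 5].

(** One bit for each entry of [triples5], so the bit sequences of size 10 are exactly the labelled
    3-graphs on five points. *)
Definition bits_edge (b : bitseq) (i j k : nat) : bool :=
  nth false b (nth 10 (nth [::] (nth [::] triple_rank i) j) k).

Fixpoint bitseqs (n : nat) : seq bitseq :=
  if n is n'.+1 then [seq x :: b | x <- [:: true; false], b <- bitseqs n']
  else [:: [::]].

Definition perms5 : seq (seq nat) :=
  Eval vm_compute in permutations (iota 0 5).

(** A single ordering can give a negative [gap], for instance when [abc] and [adf] are the only
    edges; only the sum over all orderings has a sign. It is written with [foldr] because locked big
    operators do not evaluate. *)
Lemma gap_certificate :
  all (fun b : bitseq => has (C5_F32_at (bits_edge b)) perms5
       || Z.leb Z0 (foldr Z.add Z0 [seq gap (bits_edge b) p | p <- perms5]))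
    (bitseqs 10).
Proof. by vm_compute. Qed.

Lemma mem_bitseqs n (b : bitseq) : (b \in bitseqs n) = (size b == n).
Proof.
elim: n b => [|n IHn] [|x b] //.
  by apply/negP => /allpairsP[[y c] []].
rewrite eqSS -IHn; apply/allpairsP/idP => [[[y c] [_ cn [_ ->]]]//|bn].
by exists (x, b); split=> //; case: x.
Qed.

Lemma gap_map (T T' : Type) (e : T -> T -> T -> bool) (h : T' -> T) s :
  gap e (map h s) = gap (fun i j k => e (h i) (h j) (h k)) s.
Proof. by case: s => [|a [|b [|c [|d [|f []]]]]]. Qed.

Lemma two_edges_map (T T' : Type) (e : T -> T -> T -> bool) e' (h : T' -> T) s :
  (forall i j k, e (h i) (h j) (h k) = e' i j k) ->
  two_edges e (map h s) = two_edges e' s.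
Proof. by move=> ee'; case: s => [|a [|b [|c [|d [|? ?]]]]] //=; rewrite !ee'. Qed.

Lemma C5_F32_at_map (T T' : Type) (e : T -> T -> T -> bool) (h : T' -> T) s :
  C5_F32_at e (map h s) = C5_F32_at (fun i j k => e (h i) (h j) (h k)) s.
Proof. by case: s => [|a [|b [|c [|d [|f []]]]]]. Qed.

Lemma gap_ext (T : eqType) (e e' : T -> T -> T -> bool) s :
  {in s & &, forall i j k, e i j k = e' i j k} -> gap e s = gap e' s.
Proof.
case: s => [|a [|b [|c [|d [|f []]]]]] //= ee'.
rewrite /link_dev /mixed_dev /edge_skew /nonedge_skew /=.
by rewrite !ee' // !inE !eqxx ?orbT.
Qed.

Lemma C5_F32_at_ext (T : eqType) (e e' : T -> T -> T -> bool) s :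
  {in s & &, forall i j k, e i j k = e' i j k} ->
  C5_F32_at e s = C5_F32_at e' s.
Proof.
case: s => [|a [|b [|c [|d [|f []]]]]] //= ee'.
by rewrite !ee' // !inE !eqxx ?orbT.
Qed.

(** Taking [F] on sequences lets the lemma be applied again to [fun s => F (x :: s)], one coordinate
    at a time. *)
Lemma sum_tuple_cons (V : finType) (A : nmodType) {n : nat} (F : seq V -> A) :
  (\sum_(t : n.+1.-tuple V) F t = \sum_x \sum_(t : n.-tuple V) F (x :: t))%R.
Proof.
rewrite pair_big /= (reindex (fun p : V * n.-tuple V => [tuple of p.1 :: p.2])) //.
exists (fun t => (thead t, [tuple of behead t])) => [[x t] _|t _] /=.
  by congr (_, _); apply: val_inj.
by rewrite -tuple_eta.
Qed.

Lemma sum_tuple0 (V : finType) (A : nmodType) (F : seq V -> A) :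
  (\sum_(t : 0.-tuple V) F t = F [::])%R.
Proof.
rewrite (eq_bigr (fun=> F [::])) => [|t _]; last by rewrite tuple0.
by rewrite sumr_const card_tuple expn0.
Qed.

(** * Sums of [gap] over all 5-tuples of vertices *)

Section TupleCount.
Variables (V : finType) (e : V -> V -> V -> bool).
Hypothesis e_symL : forall x y z, e x y z = e y x z.
Hypothesis e_symR : forall x y z, e x y z = e x z y.
Hypothesis e_irr : forall x y, e x x y = false.
Hypothesis e_free : forall s, ~~ C5_F32_at e s.

(** The map [h] need not be injective: pulling [e] back along it still gives a symmetric irreflexive
    relation on five points, hence one of the bit-coded 3-graphs, and [e_free] rules out the first
    alternative of the certificate. *)
Lemma gap_perms_ge0 (h : nat -> V) :
  (0 <= \sum_(p <- perms5) gap e (map h p))%R.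
Proof.
pose E i j k := e (h i) (h j) (h k).
pose b := [seq E (nth 0 s 0) (nth 0 s 1) (nth 0 s 2) | s <- triples5].
have Eb i j k : i < 5 -> j < 5 -> k < 5 -> E i j k = bits_edge b i j k.
  (* Each of the 125 index triples either has a repetition or is brought into increasing order by
     adjacent swaps. *)
  rewrite /E; do 5 try (case: i => [|i]); do 5 try (case: j => [|j]);
  do 5 try (case: k => [|k]); move=> // _ _ _;
  rewrite /b /bits_edge /= /E /=;
  by [| rewrite e_irr | rewrite e_symR e_irr | rewrite e_symL e_symR e_irr
     | rewrite e_symL | rewrite e_symR | rewrite e_symL e_symR | rewrite e_symR e_symL
     | rewrite e_symL e_symR e_symL].
have lt5 p : p \in perms5 -> {in p, forall i, i < 5}.
  move=> pP i ip; have: all (all (fun i => i < 5)) perms5 by [].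
  by move/allP/(_ p pP)/allP/(_ i ip).
have Ebp p : p \in perms5 -> {in p & &, forall i j k, E i j k = bits_edge b i j k}.
  by move=> /lt5 p5 i j k ip jp kp; apply: Eb; apply: p5.
have := allP gap_certificate b; rewrite mem_bitseqs => /(_ isT) /orP[/hasP[p pP]|].
  by rewrite -(C5_F32_at_ext (Ebp p pP)) -C5_F32_at_map (negPf (e_free _)).
rewrite foldrE big_map => le0; rewrite (eq_big_seq (fun p => gap (bits_edge b) p)) //.
by move=> p pP; rewrite gap_map; apply: gap_ext; apply: Ebp.
Qed.

(** Permuting coordinates is injective on a finite set of tuples, hence a valid reindexing. All
    entries of [p] are below 5, so the default [x0] is never read. *)
Lemma sum_tuple_perm (x0 : V) (p : seq nat) (F : seq V -> Z) :
  perm_eq p (iota 0 5) ->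
  (\sum_(t : 5.-tuple V) F (map (nth x0 t) p) = \sum_(t : 5.-tuple V) F t)%R.
Proof.
move=> pP; have szp : size p = 5 by rewrite (perm_size pP).
have szm (t : 5.-tuple V) : size (map (nth x0 t) p) == 5 by rewrite size_map szp.
rewrite [RHS](reindex_inj (h := fun t => Tuple (szm t))) // => t u [] /eq_in_map tu.
apply: eq_from_tnth => i; rewrite !(tnth_nth x0); apply: tu.
by rewrite (perm_mem pP) mem_iota ltn_ord.
Qed.

Lemma sum_gap_ge0 : (0 <= \sum_(t : 5.-tuple V) gap e t)%R.
Proof.
have [x0 _|V0] := pickP (@predT V); last first.
  by rewrite big1 // => -[[|x s] // sz] _; have := V0 x.
(* Here 120 = 5! is the number of orderings; each of them leaves the total unchanged, so the
   orderings can be summed inside each tuple. *)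
suff: (0 <= (\sum_(t : 5.-tuple V) gap e t) *+ 120)%R by rewrite pmulrn_lge0.
have -> : ((\sum_(t : 5.-tuple V) gap e t) *+ 120
    = \sum_(p <- perms5) \sum_(t : 5.-tuple V) gap e t)%R.
  by rewrite big_const_seq count_predT -Monoid.iteropE.
rewrite (eq_big_seq (fun p => \sum_(t : 5.-tuple V) gap e (map (nth x0 t) p))%R).
  by rewrite exchange_big sumr_ge0 // => t _; apply: gap_perms_ge0.
move=> p pP; rewrite sum_tuple_perm //.
have: all (perm_eq^~ (iota 0 5)) perms5 by vm_compute.
by move/allP/(_ p pP).
Qed.

Let sum5 (F : V -> V -> V -> V -> V -> Z) : Z :=
  (\sum_a \sum_b \sum_c \sum_d \sum_f F a b c d f)%R.

(** For fixed [a], [b], [c] the sum over [d] and [f] is the square of the sum of [F a b c]. *)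
Lemma sum5_square (F : V -> V -> V -> V -> Z) :
  (0 <= sum5 (fun a b c d f => F a b c d * F a b c f))%R.
Proof.
apply: sumr_ge0 => a _; apply: sumr_ge0 => b _; apply: sumr_ge0 => c _.
by rewrite -big_distrlr /= -expr2 sqr_ge0.
Qed.

(** Here only [a] is shared, and the square is that of the sum of [F a] over pairs. *)
Lemma sum5_vertex_square (F : V -> V -> V -> Z) :
  (0 <= sum5 (fun a b c d f => F a b c * F a d f))%R.
Proof.
apply: sumr_ge0 => a _.
suff -> : (\sum_b \sum_c \sum_d \sum_f F a b c * F a d f)%R
  = ((\sum_b \sum_c F a b c) ^+ 2)%R :> Z by rewrite sqr_ge0.
rewrite expr2 mulr_suml; apply: eq_bigr => b _.
rewrite mulr_suml; apply: eq_bigr => c _.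
by rewrite mulr_sumr; apply: eq_bigr => d _; rewrite mulr_sumr.
Qed.

Let sum5D F G : (sum5 (fun a b c d f => F a b c d f + G a b c d f) = sum5 F + sum5 G)%R.
Proof. by rewrite /sum5; do 5! [rewrite -big_split; apply: eq_bigr => ? _]. Qed.

Let sum5N F : (sum5 (fun a b c d f => - F a b c d f) = - sum5 F)%R.
Proof. by rewrite /sum5; do 5! [rewrite -sumrN; apply: eq_bigr => ? _]. Qed.

Let sum5Z z F : (sum5 (fun a b c d f => z * F a b c d f) = z * sum5 F)%R.
Proof. by rewrite /sum5; do 5! [rewrite mulr_sumr; apply: eq_bigr => ? _]. Qed.

Let sum5_tuple (F : seq V -> Z) :
  (\sum_(t : 5.-tuple V) F t = sum5 (fun a b c d f => F [:: a; b; c; d; f]))%R.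
Proof.
rewrite sum_tuple_cons; apply: eq_bigr => a _.
rewrite (sum_tuple_cons (fun s => F (a :: s))); apply: eq_bigr => b _.
rewrite (sum_tuple_cons (fun s => F [:: a, b & s])); apply: eq_bigr => c _.
rewrite (sum_tuple_cons (fun s => F [:: a, b, c & s])); apply: eq_bigr => d _.
rewrite (sum_tuple_cons (fun s => F [:: a, b, c, d & s])).
by apply: eq_bigr => f _; rewrite (sum_tuple0 (fun s => F [:: a, b, c, d, f & s])).
Qed.

Let sum5_affine z z1 z2 z3 z4 z5 F1 F2 F3 F4 F5 :
  (sum5 (fun a b c d f => z - z1 * F1 a b c d f
     - (z2 * F2 a b c d f + z3 * F3 a b c d f
        + z4 * F4 a b c d f + z5 * F5 a b c d f))
   = z * (#|V| ^ 5)%:R - z1 * sum5 F1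
     - (z2 * sum5 F2 + z3 * sum5 F3 + z4 * sum5 F4 + z5 * sum5 F5))%R.
Proof.
have sum_const : sum5 (fun _ _ _ _ _ => z) = (z * (#|V| ^ 5)%:R)%R.
  rewrite mulr_natr /sum5 !sumr_const -!mulrnA.
  by congr (_ *+ _)%R; rewrite !expnSr expn0 mul1n.
by rewrite -sum_const -!sum5Z -!sum5D -!sum5N -!sum5D.
Qed.

Lemma two_edges_count :
  16 * \sum_(t : 4.-tuple V) two_edges e t <= 9 * #|V| ^ 4.
Proof.
set M := \sum_t _.
have [N0|N_gt0] := posnP #|V|.
  rewrite /M big1 // => -[[|x s] // sz] _.
  by move/card0_eq/(_ x): N0.
(* The fifth coordinate is free, which gives the factor [#|V|]. *)
have sum_two : sum5 (fun a b c d f => Z.b2z (two_edges e [:: a; b; c; d]))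
    = ((M * #|V|)%:R)%R.
  rewrite /M natrM natr_sum (sum_tuple_cons (fun s => (two_edges e s)%:R)%R).
  rewrite mulr_suml; apply: eq_bigr => a _.
  rewrite (sum_tuple_cons (fun s => (two_edges e (a :: s))%:R)%R).
  rewrite mulr_suml; apply: eq_bigr => b _.
  rewrite (sum_tuple_cons (fun s => (two_edges e [:: a, b & s])%:R)%R).
  rewrite mulr_suml; apply: eq_bigr => c _.
  rewrite (sum_tuple_cons (fun s => (two_edges e [:: a, b, c & s])%:R)%R).
  rewrite mulr_suml; apply: eq_bigr => d _.
  rewrite (sum_tuple0 (fun s => (two_edges e [:: a, b, c, d & s])%:R)%R).
  by rewrite sumr_const mulr_natr; case: two_edges.
have := sum_gap_ge0; rewrite sum5_tuple.
have -> := sum5_affine 81 144 9 16 192 288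
  (fun a b c d f => Z.b2z (two_edges e [:: a; b; c; d]))
  (fun a b c d f => link_dev e a b c * link_dev e a d f)%R
  (fun a b c d f => mixed_dev e a b c d * mixed_dev e a b c f)%R
  (fun a b c d f => edge_skew e a b c d * edge_skew e a b c f)%R
  (fun a b c d f => nonedge_skew e a b c d * nonedge_skew e a b c f)%R.
have := sum5_vertex_square (link_dev e).
have := sum5_square (mixed_dev e).
have := sum5_square (edge_skew e).
have := sum5_square (nonedge_skew e).
rewrite sum_two; move: (sum5 _) (sum5 _) (sum5 _) (sum5 _) => q1 q2 q3 q4.
move=> q1_ge0 q2_ge0 q3_ge0 q4_ge0 S_ge0.
(* Restoring the factor [#|V|] leaves 144 * A <= 81 * B divided by 9. *)
rewrite -(leq_pmul2r N_gt0) -(mulnA 16) -(mulnA 9) -expnSr.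
move: (M * _) (_ ^ 5) S_ge0 => A B S_ge0; lia.
Qed.

End TupleCount.

(** * Counting copies of 4.2 *)

Definition edge (V : finType) (G : graph3 V) (x y z : V) : bool :=
  [set x; y; z] \in edges G.

Lemma setD1_of_card3 (T : finType) (S E : {set T}) :
  #|S| = 4 -> #|E| = 3 -> E \subset S -> exists2 v, v \in S & E = S :\ v.
Proof.
move=> S4 E3 ES.
have /eqP/cards1P[v vE] : #|S :\: E| = 1.
  by rewrite cardsD (finset.setIidPr ES) S4 E3.
exists v; first by have := set11 v; rewrite -vE inE => /andP[].
by rewrite -vE finset.setDDr finset.setDv finset.set0U; apply/esym/finset.setIidPr.
Qed.

Lemma card3_ord4 (A : {set 'I_4}) : #|A| = 3 ->
  [\/ A = triple 3 1 2 3, A = triple 3 1 2 4, A = triple 3 1 3 4 | A = triple 3 2 3 4].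
Proof.
move=> A3.
have [i _ ->] := setD1_of_card3 (S := [set: 'I_4]) (etrans (cardsT _) (card_ord 4)) A3
  (finset.subsetT A).
case: i => [[|[|[|[|i]]]] // i4]; [apply: Or44|apply: Or43|apply: Or42|apply: Or41];
by apply/setP => -[[|[|[|[|j]]]] // j4]; rewrite !inE -!val_eqE /= !inordK.
Qed.

Section Graph.
Variables (V : finType) (G : graph3 V).

Lemma edgeL x y z : edge G x y z = edge G y x z.
Proof. by rewrite /edge (finset.setUC [set x]). Qed.

Lemma edgeR x y z : edge G x y z = edge G x z y.
Proof. by rewrite /edge finset.setUAC. Qed.

Lemma card_edge E : E \in edges G -> #|E| = 3.
Proof. by move/(forall_inP (edges_card3 G))/eqP. Qed.

Lemma edge_irr x y : edge G x x y = false.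
Proof.
apply/negP => /card_edge; rewrite finset.setUid cards2.
by case: (_ != _).
Qed.

Lemma edge_neq x y z : edge G x y z -> [&& x != y, x != z & y != z].
Proof.
move=> xyz; apply/and3P; split; apply: contraTneq xyz => ->.
- by rewrite edge_irr.
- by rewrite edgeR edge_irr.
- by rewrite edgeL edgeR edge_irr.
Qed.

Lemma imset_triple n (f : 'I_n.+1 -> V) i j k :
  f @: triple n i j k = [set f (inord i.-1); f (inord j.-1); f (inord k.-1)].
Proof. by rewrite /triple !imsetU !imset_set1. Qed.

(** The pattern forces its five vertices to be distinct: any two of them lie in one of the listed
    edges, and an edge has three distinct vertices. Sampling with repetition therefore creates no
    new forbidden pattern. *)
Lemma C5_F32_at_free : family_free C5_F32 G -> forall s, ~~ C5_F32_at (edge G) s.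
Proof.
move=> freeG [|a [|b [|c [|d [|f []]]]]] //=; apply/negP.
pose h (i : 'I_5) := nth a [:: a; b; c; d; f] i.
have hE i : i < 5 -> h (inord i) = nth a [:: a; b; c; d; f] i.
  by move=> i5; rewrite /h inordK.
have h_inj : uniq [:: a; b; c; d; f] -> injective h.
  move=> U i j /eqP; rewrite nth_uniq //= => /eqP ij; exact: val_inj.
case/orP.
  case/and5P=> e1 e2 e3 e4 e5.
  apply: (freeG (existT _ 5 C5)); first by left.
  exists h => [|E].
    apply: h_inj; rewrite /= !inE !negb_or !andbT.
    case/and3P: (edge_neq e1) => -> -> ->.
    case/and3P: (edge_neq e2) => _ -> ->.
    case/and3P: (edge_neq e3) => _ -> ->.
    case/and3P: (edge_neq e4); rewrite ![_ == a]eq_sym => _ -> ->.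
    by case/and3P: (edge_neq e5) => _; rewrite eq_sym => ->.
  rewrite /= !inE -!orbA => /or4P[/eqP->|/eqP->|/eqP->|/orP[]/eqP->];
  by rewrite imset_triple !hE.
case/and4P=> e1 e2 e3 e4.
apply: (freeG (existT _ 5 F32)); first by right.
exists h => [|E].
  apply: h_inj; rewrite /= !inE !negb_or !andbT.
  case/and3P: (edge_neq e1) => -> -> ->.
  case/and3P: (edge_neq e2) => _ -> ->.
  case/and3P: (edge_neq e3) => _ -> ->.
  by case/and3P: (edge_neq e4) => -> -> ->.
rewrite /= !inE -!orbA => /or4P[]/eqP->; by rewrite imset_triple !hE.
Qed.

(** The hypotheses make [f] an isomorphism from [H] onto the subgraph induced on [B]; on edges the
    inverse of taking images is taking preimages. *)
Lemma card_imset_edges (W : finType) (H : graph3 W) (f : W -> V) (B : {set V}) :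
  injective f -> (forall E, (E \in edges H) = (f @: E \in edges G)) ->
  (forall x, x \in B -> exists y, x = f y) ->
  (forall y, f y \in B) ->
  #|[set E in edges G | E \subset B]| = #|edges H|.
Proof.
move=> f_inj fE fB Bf.
rewrite -(card_imset (mem (edges H)) (imset_inj f_inj)); apply: eq_card => E.
rewrite !inE; apply/andP/imsetP => [[EG EB]|[E' E'H ->]].
  have EE : E = f @: (f @^-1: E).
    apply/setP => x; apply/idP/imsetP => [xE|[y]]; last by rewrite inE => ? ->.
    have [y xy] := fB _ (fintype.subsetP EB x xE).
    by exists y => //; rewrite inE -xy.
  by exists (f @^-1: E) => //; rewrite fE -EE.
split; first by rewrite -fE.
by apply/fintype.subsetP => _ /imsetP[y _ ->].
Qed.

(** * Induced copies of 4.2 as 4-sets spanning two edges *)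

Lemma card_edges_4_2 : #|edges_4_2| = 2.
Proof.
rewrite cards2; case: eqP => // /setP/(_ (inord 2)).
by rewrite !inE -!val_eqE /= !inordK.
Qed.

Lemma isomorphic_4_2_card (S : {set V}) :
  isomorphic (Defs.induced G S) G_4_2 -> #|[set E in edges G | E \subset S]| = 2.
Proof.
case=> f f_bij fE; rewrite -card_edges_4_2.
rewrite (@card_imset_edges _ (Defs.induced G S) val).
- have fS_inj := imset_inj (bij_inj f_bij).
  rewrite -(card_imset (mem (edges (Defs.induced G S))) fS_inj).
  apply: eq_card => E; apply/imsetP/idP => [[E' E'G ->]|EH]; first by rewrite -fE.
  have [g fg gf] := f_bij.
  have EE : E = f @: (g @: E).
    by rewrite -imset_comp -[LHS]imset_id; apply: eq_imset => x /=; rewrite gf.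
  by exists (g @: E) => //; rewrite fE -EE.
- exact: val_inj.
- by move=> E; rewrite inE.
- by move=> x xS; exists (Sub x xS).
- by move=> y; apply: valP.
Qed.

(** Edges inside a 4-set are the complements of single vertices, so it suffices to count the
    vertices whose removal leaves an edge. *)
Lemma card_sub_edges a b c d : uniq [:: a; b; c; d] ->
  #|[set E in edges G | E \subset [set x in [:: a; b; c; d]]]| =
  edge G a b c + edge G a b d + edge G a c d + edge G b c d.
Proof.
move=> U; set S := [set x in _].
have S4 : #|S| = 4 by rewrite cardsE (card_uniqP U).
have D_inj : {in S &, injective (fun v => S :\ v)}.
  move=> v w vS wS vw; apply/eqP; apply: contraT => nvw.
  have: w \in S :\ v by rewrite finset.in_setD1 eq_sym nvw.
  by rewrite vw finset.in_setD1 eqxx.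
have -> : [set E in edges G | E \subset S] =
    [set S :\ v | v in [set v in S | S :\ v \in edges G]].
  apply/setP => E; rewrite inE; apply/andP/imsetP => [[EG ES]|[v]].
    have [v vS ED] := setD1_of_card3 S4 (card_edge EG) ES.
    by exists v => //; rewrite inE vS -ED.
  by rewrite inE => /andP[vS vG] ->; rewrite finset.subD1set.
rewrite card_in_imset => [|v w]; last first.
  by move=> /finset.setIdP[vS _] /finset.setIdP[wS _]; apply: D_inj.
have -> : [set v in S | S :\ v \in edges G] =
    [set x in [seq v <- [:: a; b; c; d] | S :\ v \in edges G]].
  by apply/setP => v; rewrite !inE mem_filter andbC !inE.
rewrite cardsE (card_uniqP _) ?filter_uniq // size_filter /=.
have dS v x y z : S = v |: [set x; y; z] -> v \notin [set x; y; z] ->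
    (S :\ v \in edges G) = edge G x y z.
  by move=> -> vxyz; rewrite finset.setU1K.
move: U; rewrite /= !inE !negb_or !andbT => /and3P[/and3P[ab ac ad] /andP[bc bd] cd].
have SE v x y z : (forall u, (u \in [:: a; b; c; d]) = (u \in [:: v; x; y; z])) ->
    S = v |: [set x; y; z].
  by move=> uE; apply/setP => u; have := uE u; rewrite !inE -!orbA.
have -> : (S :\ a \in edges G) = edge G b c d.
  apply: dS; last by rewrite !inE !negb_or ab ac ad.
  exact: SE.
have -> : (S :\ b \in edges G) = edge G a c d.
  apply: dS; last by rewrite !inE !negb_or eq_sym ab bc bd.
  by apply: SE => u; rewrite !inE; do 4! case: (u == _).
have -> : (S :\ c \in edges G) = edge G a b d.
  apply: dS; last by rewrite !inE !negb_or !(eq_sym c) ac bc [d == c]eq_sym cd.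
  by apply: SE => u; rewrite !inE; do 4! case: (u == _).
have -> : (S :\ d \in edges G) = edge G a b c.
  apply: dS; last by rewrite !inE !negb_or !(eq_sym d) ad bd cd.
  by apply: SE => u; rewrite !inE; do 4! case: (u == _).
lia.
Qed.

(** The common pair of the two edges is listed first, matching labels 1 and 2 of [G_4_2]; the
    isomorphism sends a vertex to its position in the list. *)
Lemma isomorphic_4_2_edges (S : {set V}) a b c d :
  uniq [:: a; b; c; d] -> S = [set x in [:: a; b; c; d]] ->
  edge G a b c -> edge G a b d -> ~~ edge G a c d -> ~~ edge G b c d ->
  isomorphic (Defs.induced G S) G_4_2.
Proof.
move=> U SE abc abd acd bcd.
pose g (i : 'I_4) := nth a [:: a; b; c; d] i.
have g_inj : injective g.
  by move=> i j /eqP; rewrite nth_uniq // => /eqP; apply: val_inj.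
have memS x : (x \in S) = (x \in [:: a; b; c; d]) by rewrite SE inE.
pose f (w : {x : V | x \in S}) : 'I_4 := inord (index (val w) [:: a; b; c; d]).
have wS (w : {x : V | x \in S}) : val w \in [:: a; b; c; d].
  by rewrite -memS; apply: valP.
have gf w : g (f w) = val w.
  by rewrite /g /f inordK ?nth_index // -[4]/(size [:: a; b; c; d]) index_mem.
have f_inj : injective f.
  by move=> v w fvw; apply: val_inj; rewrite -!gf fvw.
have cardS : #|{: {x : V | x \in S}}| = 4.
  rewrite card_sig -[4]/(size [:: a; b; c; d]) -(card_uniqP U).
  by apply: eq_card => x; rewrite inE memS.
exists f; first by apply: inj_card_bij; rewrite ?card_ord ?cardS.
move=> E; rewrite inE.
have -> : val @: E = g @: (f @: E).
  by rewrite -imset_comp; apply: eq_imset => w /=; rewrite gf.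
move: (f @: E) => A {E}.
have [A3|A3] := eqVneq #|A| 3; last first.
  transitivity false; last apply/esym; apply: contraNF A3.
    by move/card_edge; rewrite card_imset // => ->.
  by move/(forall_inP edges_4_2_card3).
have gE i : i < 4 -> g (inord i) = nth a [:: a; b; c; d] i.
  by move=> i4; rewrite /g inordK.
have [] := card3_ord4 A3 => ->; rewrite imset_triple !gE //=.
- by rewrite -/(edge G a b c) abc !inE eqxx.
- by rewrite -/(edge G a b d) abd !inE eqxx orbT.
- rewrite -/(edge G a c d) (negPf acd); apply/esym/negP; rewrite !inE.
  (* Label 2, that is [inord 1], lies in both edges of [G_4_2] but not in 134; label 1 separates 234
     in the same way below. *)
  case/orP=> /eqP/setP/(_ (inord 1)); by rewrite !inE -!val_eqE /= !inordK.
- rewrite -/(edge G b c d) (negPf bcd); apply/esym/negP; rewrite !inE.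
  case/orP=> /eqP/setP/(_ (inord 0)); by rewrite !inE -!val_eqE /= !inordK.
Qed.

(** Two distinct triples in a 4-set always share a pair, so two edges determine the 3-graph up to
    isomorphism. The six choices of edges reduce to one by listing the shared pair first. *)
Lemma isomorphic_4_2P a b c d : uniq [:: a; b; c; d] ->
  isomorphic (Defs.induced G [set x in [:: a; b; c; d]]) G_4_2 <->
  two_edges (edge G) [:: a; b; c; d].
Proof.
move=> U; split=> [/isomorphic_4_2_card|].
  by rewrite card_sub_edges //= => ->.
have SP s : perm_eq s [:: a; b; c; d] ->
    uniq s /\ [set x in [:: a; b; c; d]] = [set x in s].
  move=> sP; rewrite (perm_uniq sP); split=> //.
  by apply/setP => x; rewrite !finset.in_set (perm_mem sP).
have perm_iso p q r s : perm_eq [:: p; q; r; s] [:: a; b; c; d] ->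
    edge G p q r -> edge G p q s -> ~~ edge G p r s -> ~~ edge G q r s ->
    isomorphic (Defs.induced G [set x in [:: a; b; c; d]]) G_4_2.
  by move=> /SP[Us Ss]; apply: isomorphic_4_2_edges.
rewrite /=.
case abc: (edge G a b c); case abd: (edge G a b d);
case acd: (edge G a c d); case bcd: (edge G b c d) => //= _;
  [apply: (perm_iso a b c d)|apply: (perm_iso a c b d)|apply: (perm_iso b c a d)
  |apply: (perm_iso a d b c)|apply: (perm_iso b d a c)|apply: (perm_iso c d a b)];
  try by [rewrite ?(abc, abd, acd, bcd) | rewrite edgeL ?(abc, abd, acd, bcd)
     | rewrite edgeR ?(abc, abd, acd, bcd)
     | rewrite edgeL edgeR ?(abc, abd, acd, bcd)
     | rewrite edgeR edgeL ?(abc, abd, acd, bcd)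
     | rewrite edgeL edgeR edgeL ?(abc, abd, acd, bcd)].
all: apply/permP => u /=; lia.
Qed.

(** Grouping tuples by their underlying set gives 4! = 24 orderings for each copy. *)
Lemma ind_count_4_2 :
  #|[set t : 4.-tuple V | uniq t && two_edges (edge G) t]| = 24 * ind_count G_4_2 G.
Proof.
pose Q (S : {set V}) := (#|S| == 4) && `[< isomorphic (Defs.induced G S) G_4_2 >].
have PQ (t : 4.-tuple V) : uniq t -> Q [set x in t] = two_edges (edge G) t.
  case: t => [[|a [|b [|c [|d [|? ?]]]]] // sz] U.
  rewrite /Q cardsE (card_uniqP U) eqxx /=.
  by apply/asboolP/idP; have [] := isomorphic_4_2P U.
rewrite -sum1dep_card.
rewrite (partition_big (fun t : 4.-tuple V => [set x in t]) Q) => /=; last first.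
  by move=> t /andP[U]; rewrite PQ.
rewrite /ind_count card_ord mulnC -sum_nat_const.
apply: eq_big => [S|S QS]; first by rewrite inE.
rewrite sum1dep_card; case/andP: (QS) => /eqP S4 _.
transitivity (#|[set t : 4.-tuple V | all [in S] t & uniq t]|); last first.
  by rewrite card_uniq_tuples S4.
apply: eq_card => t; rewrite !inE.
apply/andP/andP => [[/andP[U _] /eqP <-]|[tS U]].
  by split=> //; apply/allP => x xt; rewrite inE.
have St : [set x in t] = S.
  apply/eqP; rewrite eqEcard S4 cardsE (card_uniqP U) size_tuple leqnn andbT.
  by apply/fintype.subsetP => x; rewrite inE => /(allP tS).
by split; [rewrite U -PQ // St | apply/eqP].
Qed.

Lemma ind_count_4_2_le :
  family_free C5_F32 G -> 16 * (24 * ind_count G_4_2 G) <= 9 * #|V| ^ 4.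
Proof.
move=> freeG.
apply: leq_trans (two_edges_count edgeL edgeR edge_irr (C5_F32_at_free freeG)).
(* Dropping the condition [uniq] only adds tuples, which is harmless for an upper bound. *)
rewrite leq_mul2l /= -ind_count_4_2 -sum1dep_card big_mkcond /=.
by apply: leq_sum => t _; case: uniq.
Qed.

End Graph.

(** * The balanced blow-up of the complete 3-graph on four vertices *)

Section Blowup.
Variable n : nat.

(** The four parts are the residue classes modulo 4, so their sizes differ by at most one. *)
Definition blowup_edges : {set {set 'I_n}} :=
  [set E : {set 'I_n} | (#|E| == 3) &&
    [forall x in E, forall y in E, (x != y) ==> (x %% 4 != y %% 4)]].

Fact blowup_card3 : [forall E in blowup_edges, #|E| == 3].
Proof. by apply/forall_inP => E; rewrite inE => /andP[]. Qed.

Definition blowup : graph3 'I_n := Graph3 blowup_card3.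

Lemma blowup_edgeE x y z :
  edge blowup x y z = uniq [:: x %% 4; y %% 4; z %% 4].
Proof.
rewrite /edge inE; apply/andP/idP => [[xyz3 /forall_inP colP]|U].
  have /and3P[xy xz yz] : [&& x != y, x != z & y != z].
    apply: (@edge_neq _ blowup); rewrite /edge inE xyz3; exact/forall_inP.
  have col u v : u \in [set x; y; z] -> v \in [set x; y; z] -> u != v -> u %% 4 != v %% 4.
    by move=> uE vE; apply/implyP; have /forall_inP := colP u uE; apply.
  by rewrite /= !inE negb_or !col // !inE eqxx ?orbT.
have [xy xz yz] : [/\ x != y, x != z & y != z].
  by split; apply: contraTneq U => ->; rewrite /= !inE eqxx ?orbT ?andbF.
split; first by rewrite finset.setUC cardsU1 cards2 !inE negb_or xy ![z == _]eq_sym xz yz.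
move: U; rewrite /= !inE negb_or andbT => /andP[/andP[cxy cxz] cyz].
apply/forall_inP => u uE; apply/forall_inP => v; move: uE; rewrite !inE -!orbA.
by case/or3P=> /eqP-> /or3P[]/eqP->; rewrite ?eqxx // [X in _ ==> ~~ X]eq_sym
  ?cxy ?cxz ?cyz ?implybT // [X in _ ==> ~~ X]eq_sym
  ?cxy ?cxz ?cyz ?implybT.
Qed.

(* The five vertices of [K] would need pairwise distinct colours. *)
Lemma blowup_covering_free (K : graph3 'I_5) :
  (forall i j : 'I_5, i < j -> exists2 E, E \in edges K & (i \in E) && (j \in E)) ->
  ~ subgraph K blowup.
Proof.
move=> cov [f f_inj fK].
pose g (i : 'I_5) : 'I_4 := inord (f i %% 4).
suff g_inj : injective g by have := leq_card g g_inj; rewrite !card_ord.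
have gij (i j : 'I_5) : i < j -> g i != g j.
  move=> ij; have [E EK /andP[iE jE]] := cov i j ij.
  have := fK E EK; rewrite inE => /andP[_ /forall_inP/(_ _ (imset_f f iE))].
  move=> /forall_inP/(_ _ (imset_f f jE)) /implyP.
  rewrite (inj_eq f_inj) -!val_eqE /= !inordK ?ltn_pmod //; apply.
  by rewrite neq_ltn ij.
move=> i j; case: (ltngtP i j) => [/gij/eqP//|/gij/eqP|] ij gE; first by rewrite gE in ij.
exact: val_inj.
Qed.

Lemma blowup_free : family_free C5_F32 blowup.
Proof.
move=> _ [->|->] /=; apply: blowup_covering_free.
  move=> [[|[|[|[|[|i]]]]] i5] [[|[|[|[|[|j]]]]] j5] // _;
  by [exists (triple 4 1 2 3); rewrite !inE ?eqxx ?orbT // -!val_eqE /= !inordK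
     |exists (triple 4 2 3 4); rewrite !inE ?eqxx ?orbT // -!val_eqE /= !inordK
     |exists (triple 4 3 4 5); rewrite !inE ?eqxx ?orbT // -!val_eqE /= !inordK
     |exists (triple 4 4 5 1); rewrite !inE ?eqxx ?orbT // -!val_eqE /= !inordK
     |exists (triple 4 5 1 2); rewrite !inE ?eqxx ?orbT // -!val_eqE /= !inordK].
move=> [[|[|[|[|[|i]]]]] i5] [[|[|[|[|[|j]]]]] j5] // _;
by [exists (triple 4 1 2 3); rewrite !inE ?eqxx ?orbT // -!val_eqE /= !inordK
   |exists (triple 4 1 2 4); rewrite !inE ?eqxx ?orbT // -!val_eqE /= !inordK
   |exists (triple 4 1 2 5); rewrite !inE ?eqxx ?orbT // -!val_eqE /= !inordK
   |exists (triple 4 3 4 5); rewrite !inE ?eqxx ?orbT // -!val_eqE /= !inordK].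
Qed.

Definition rainbow (x y z : nat) : bool := uniq [:: x; y; z].

(** The patterns are those of type (2, 1, 1): 4 repeated colours, 6 pairs of positions for them, and
    3 * 2 choices for the other two positions. Passing to sums over [nat] lets the count be
    evaluated. *)
Lemma card_two_rainbow :
  #|[set c : 4.-tuple 'I_4 | two_edges (fun x y z : 'I_4 => rainbow x y z) c]| = 144.
Proof.
pose F (s : seq 'I_4) : nat := two_edges (fun x y z : 'I_4 => rainbow x y z) s.
transitivity (\sum_(c : 4.-tuple 'I_4) F c).
  by rewrite -sum1dep_card big_mkcond; apply: eq_bigr => c _; rewrite /F; case: two_edges.
transitivity (\sum_(0 <= x < 4) \sum_(0 <= y < 4) \sum_(0 <= z < 4) \sum_(0 <= w < 4)
   two_edges rainbow [:: x; y; z; w]); last by rewrite unlock.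
rewrite (sum_tuple_cons F) big_mkord; apply: eq_bigr => x _.
rewrite (sum_tuple_cons (fun s => F (x :: s))) big_mkord; apply: eq_bigr => y _.
rewrite (sum_tuple_cons (fun s => F [:: x, y & s])) big_mkord; apply: eq_bigr => z _.
rewrite (sum_tuple_cons (fun s => F [:: x, y, z & s])) big_mkord; apply: eq_bigr => w _.
by rewrite (sum_tuple0 (fun s => F [:: x, y, z, w & s])).
Qed.

Fact lift_subproof (c : 'I_4) (q : 'I_(n %/ 4)) : 4 * q + c < n.
Proof. by have := ltn_ord c; have := ltn_ord q; lia. Qed.

Definition lift_vertex (c : 'I_4) (q : 'I_(n %/ 4)) : 'I_n :=
  Ordinal (lift_subproof c q).

Lemma lift_vertex_inj c q c' q' :
  lift_vertex c q = lift_vertex c' q' -> c = c' /\ q = q'.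
Proof.
move=> [] cq; have := ltn_ord c; have := ltn_ord c'.
by split; apply: val_inj => /=; lia.
Qed.

(** Each good colour pattern is combined with four distinct indices inside the parts. Asking for
    distinct indices even across different colours makes the vertices distinct and costs only
    lower-order terms. *)
Lemma ind_count_blowup : 144 * (n %/ 4) ^_ 4 <= 24 * ind_count G_4_2 blowup.
Proof.
rewrite -ind_count_4_2 -card_two_rainbow.
have -> : (n %/ 4) ^_ 4 = #|[set q : 4.-tuple 'I_(n %/ 4) | uniq q]|.
  rewrite -{1}[n %/ 4]card_ord -card_uniq_tuples; apply: eq_card => q.
  by rewrite !inE; have -> : all predT q by apply/allP.
rewrite -cardsX.
pose h (p : 4.-tuple 'I_4 * 4.-tuple 'I_(n %/ 4)) : 4.-tuple 'I_n :=
  [tuple lift_vertex (tnth p.1 i) (tnth p.2 i) | i < 4].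
have h_inj : injective h.
  move=> [c q] [c' q'] /(congr1 (fun t => tnth t)) cq.
  have cqi i : tnth c i = tnth c' i /\ tnth q i = tnth q' i.
    by apply: lift_vertex_inj; have := congr1 (@^~ i) cq; rewrite !tnth_mktuple.
  by congr (_, _); apply: eq_from_tnth => i; case: (cqi i).
rewrite -(card_imset _ h_inj).
apply/subset_leq_card/fintype.subsetP => t /imsetP[[c q] cq ->].
move: cq; rewrite !inE /= => /andP[c2 Uq]; apply/andP; split.
  rewrite map_inj_uniq ?enum_uniq // => i j /lift_vertex_inj[_].
  exact: (tuple_uniqP _ Uq).
rewrite (two_edges_map (e' := fun i j k => rainbow (tnth c i) (tnth c j) (tnth c k))).
  rewrite -(two_edges_map (e := fun x y z : 'I_4 => rainbow x y z) (h := tnth c)) //.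
  by rewrite map_tnth_enum.
move=> i j k; rewrite blowup_edgeE /rainbow /=.
by rewrite ![4 * _]mulnC !modnMDl !modn_small.
Qed.

End Blowup.

(** * The limit *)

Lemma ex_count_le n : 16 * (24 * ex_count G_4_2 n C5_F32) <= 9 * n ^ 4.
Proof.
rewrite /ex_count; elim/big_ind: _ => [|i j|G /asboolP/ind_count_4_2_le]; [lia|lia|].
by rewrite card_ord.
Qed.

Lemma ex_count_ge n : 144 * (n %/ 4) ^_ 4 <= 24 * ex_count G_4_2 n C5_F32.
Proof.
apply: leq_trans (ind_count_blowup n) _; rewrite leq_mul2l /=.
by apply: (leq_bigmax_cond (blowup n)); apply/asboolP/blowup_free.
Qed.

Lemma ffact4_ge n : (n - 3) ^ 4 <= n ^_ 4.
Proof.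
rewrite !ffactnS ffactn0 !expnS expn0.
by rewrite leq_mul ?leq_subr // leq_mul ?leq_mul //; lia.
Qed.

Lemma ffact4_le n : n ^_ 4 <= n ^ 4.
Proof.
rewrite !ffactnS ffactn0 !expnS expn0.
by rewrite leq_mul // leq_mul ?leq_mul //; lia.
Qed.

Lemma ffact4_bin n : 24 * 'C(n, 4) = n ^_ 4.
Proof. by rewrite -bin_ffact mulnC. Qed.

Section Limit.
Local Open Scope ring_scope.
Local Open Scope classical_set_scope.

Lemma cvg_one_sub_div (R : realType) (k : R) :
  (fun n : nat => 1 - k / n%:R : R) @ \oo --> (1 : R).
Proof.
rewrite -[X in _ --> X]subr0 -[X in _ --> _ - X](mulr0 k).
apply: cvgB; first exact: cvg_cst.
apply: cvgMl_tmp.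
have natV_gt0 : \forall n \near \oo, 0 < (n%:R : R).
  by near=> n; rewrite ltr0n; near: n; exact: nbhs_infty_gt.
by apply/(gtr0_cvgV0 natV_gt0); exact: cvgr_idn.
Unshelve. all: by end_near.
Qed.

(** The 3 comes from bounding the falling factorial below by [(n - 3) ^ 4]. The 15 is 3 lost in
    rounding [n] down to a multiple of 4, plus 4 * 3 from the same bound applied to [n %/ 4]. *)
Lemma ex_density_bounds (R : realType) n : (16 <= n)%N ->
  9 / 16 * (1 - 15 / n%:R) ^+ 4 <= (
  (ex_count G_4_2 n C5_F32)%:R / 'C(n, 4)%:R : R) <=
  9 / 16 * (1 - 3 / n%:R)^-1 ^+ 4.
Proof.
move=> n16.
set X := ex_count _ _ _.
have n_gt0 : 0 < n%:R :> R by rewrite ltr0n; lia.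
have n3_gt0 : 0 < n%:R - 3 :> R by rewrite -natrB ?ltr0n; lia.
have n_neq0 := lt0r_neq0 n_gt0; have n3_neq0 := lt0r_neq0 n3_gt0.
have n3E : (n - 3)%:R = n%:R - 3 :> R by rewrite natrB //; lia.
have n15E : (n - 15)%:R = n%:R - 15 :> R by rewrite natrB //; lia.
have ff_ge : (n%:R - 3) ^+ 4 <= (n ^_ 4)%:R :> R.
  by rewrite -n3E -natrX ler_nat ffact4_ge.
have ff_le : (n ^_ 4)%:R <= n%:R ^+ 4 :> R.
  by rewrite -natrX ler_nat ffact4_le.
have ff_gt0 : 0 < (n ^_ 4)%:R :> R by apply: lt_le_trans ff_ge; rewrite exprn_gt0.
have -> : X%:R / 'C(n, 4)%:R = (24 * X)%:R / (n ^_ 4)%:R :> R.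
  rewrite -ffact4_bin !natrM -mulf_div divff ?mul1r //.
apply/andP; split.
  rewrite ler_pdivlMr //.
  apply: (@le_trans _ _ ((144 * (n %/ 4) ^_ 4)%:R)); last by rewrite ler_nat ex_count_ge.
  apply: (@le_trans _ _ (9 / 16 * (n%:R - 15) ^+ 4)).
    have -> : 1 - 15 / n%:R = (n%:R - 15) / n%:R :> R by rewrite mulrBl divff.
    rewrite expr_div_n (mulrA (9 / 16)) mulrAC ler_pdivrMr ?exprn_gt0 //.
    by rewrite ler_wpM2l // mulr_ge0 ?exprn_ge0 // -n15E.
  (* The constants match since 16 * 144 = 9 * 4 ^ 4. *)
  have le_nat : (9 * (n - 15) ^ 4 <= 16 * (144 * (n %/ 4) ^_ 4))%N.
    have := ffact4_ge (n %/ 4).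
    have : ((n - 15) ^ 4 <= (4 * (n %/ 4 - 3)) ^ 4)%N by rewrite leq_exp2r //; lia.
    rewrite expnMn; lia.
  have : (9 * (n - 15) ^ 4)%:R <= (16 * (144 * (n %/ 4) ^_ 4))%:R :> R by rewrite ler_nat.
  rewrite natrM natrX n15E [X in _ <= X]natrM; lra.
rewrite ler_pdivrMr //.
apply: (@le_trans _ _ (9 / 16 * n%:R ^+ 4)).
  have : (16 * (24 * X))%:R <= (9 * n ^ 4)%:R :> R by rewrite ler_nat ex_count_le.
  rewrite natrM [X in _ <= X]natrM natrX; lra.
have -> : 1 - 3 / n%:R = (n%:R - 3) / n%:R :> R by rewrite mulrBl divff.
rewrite invf_div expr_div_n [X in _ <= X * _]mulrA [leRHS]mulrAC.
by rewrite ler_pdivlMr ?exprn_gt0 // ler_wpM2l // mulr_ge0 ?exprn_ge0 // ltW.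
Qed.

End Limit.

Theorem theorem2p10 (R : realType) :
  turan_density R G_4_2 C5_F32 = (9%:R / 16%:R)%R.
Proof.
apply: cvg_lim => //; rewrite card_ord.
(* Both bounds have the form [9 / 16 * u n ^+ 4] with [u] tending to 1, so one limit serves both
   sides of the squeeze. *)
have cvg4 (u : nat -> R) : (u @ \oo --> (1 : R)%R)%classic ->
    ((fun n => 9 / 16 * u n ^+ 4)%R @ \oo --> (9%:R / 16%:R : R)%R)%classic.
  move=> u1; rewrite -[X in (_ --> X)%classic]mulr1 -(expr1n _ 4).
  apply: cvgMl_tmp.
  exact: (cvg_comp _ _ u1 (@exprn_continuous R 4 1%R)).
apply: (squeeze_cvgr _ (cvg4 _ (cvg_one_sub_div 15%R))
  (cvg4 (fun n => (1 - 3 / n%:R)^-1)%R _)).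
  by near=> n; apply: ex_density_bounds; near: n; apply: nbhs_infty_ge.
rewrite -[X in (_ --> X)%classic]invr1.
by apply: cvgV; [rewrite oner_neq0|apply: cvg_one_sub_div].
Unshelve. all: by end_near.
Qed.
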